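(* Let $G$ be a simple loony endgame with at least two 3-chains. (a) If $cv(G)\ge2$ then $v(G)=cv(G)$. (b) If $cv(G)<2$ and $cv(G)$ is even, then $v(G)=2$, except if $G$ has a 4-loop and $cv(G\backslash 4_\ell)=4$, in which case $v(G)=0$. (c) If $cv(G)<2$ and $cv(G)$ is odd then $v(G)=1$.
   Context: Game. A dots and boxes game (position) $G$ consists of a finite set of unclaimed boxes and a finite set of undrawn lines, each undrawn line bordering either exactly one box or exactly two distinct boxes, each box being bordered by at least one and at most four undrawn lines. Two players play. The player to move draws (removes) an undrawn line; every box none of whose bordering lines is still undrawn is then claimed by that player. If the move claims at least one box the same player must move again (if a line remains); otherwise the other player moves. Claiming a box when possible is not compulsory. The game ends when no line remains. Each player maximises (own boxes) minus (opponent's boxes), counting only boxes claimed from $G$ onwards. Value. $v(G)$ is the net score, under optimal play, of the player who is NOT to move in $G$. Equivalently, $v(G)=0$ if $G$ has no undrawn lines, and otherwise $v(G)=\min_m v(G;m)$ over undrawn lines $m$, where, if drawing $m$ claims $k$ boxes and leaves the position $G_m$, then $v(G;m)=v(G_m)-k$ if $k\ge1$ and $v(G;m)=-v(G_m)$ if $k=0$. Chains and loops. An $n$-chain (denoted $n$) has boxes $b_1,\dots,b_n$ and lines $e_0,\dots,e_n$, where $e_i$ borders $b_i,b_{i+1}$ for $1\le i\le n-1$, $e_0$ borders only $b_1$ and $e_n$ borders only $b_n$. An $n$-loop ($n\ge4$, denoted $n_\ell$) has boxes $b_1,\dots,b_n$ and lines $e_1,\dots,e_n$, $e_i$ bordering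 $b_i,b_{i+1}$ (indices mod $n$). A simple loony endgame is a finite (possibly empty) disjoint union of chains of length at least 3 and loops of even length at least 4. $G\backslash 4_\ell$ is $G$ with one 4-loop removed. Controlled value. If $G$ is a simple loony endgame with chains of lengths $c_i$ and loops of lengths $\ell_j$, then $fcv(G)=\sum_i(c_i-4)+\sum_j(\ell_j-8)$ and $cv(G)=fcv(G)+tb(G)$, where the terminal bonus $tb(G)$ is: $0$ if $G$ is empty; $4$ if $G$ is non-empty and has a chain of length at least 4 or has no loops; $8$ if $G$ has loops but no chains; $6$ if $G$ has both chains and loops and all its chains are 3-chains. *)

(* Defs.v *)
From mathcomp Require Import all_boot all_order all_algebra.

Set Implicit Arguments.
Unset Strict Implicit.
Unset Printing Implicit Defensive.

Import Order.TTheory GRing.Theory Num.Theory.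

Local Open Scope ring_scope.

Record board := Board {
  box : finType;
  line : finType;
  borders : line -> box -> bool
}.

Definition is_position (G : board) : Prop :=
  (forall e : line G, (1 <= #|[set b | borders e b]| <= 2)%N) /\
  (forall b : box G, (1 <= #|[set e | borders e b]| <= 4)%N).

Record position := Position {
  position_board :> board;
  positionP : is_position position_board
}.

Definition board_iso (G H : board) : Prop :=
  exists (f : box G -> box H) (g : line G -> line H),
    [/\ bijective f, bijective g &
        forall e b, borders (g e) (f b) = borders e b].

Section Value.

Variable G : board.
Implicit Types (S : {set line G}) (m : line G).

(* A position reached from [G] is given by the set [S] of its undrawn lines;
   its unclaimed boxes are those bordered by some line in [S]. *)

Definition claimed S m : {set box G} :=
  [set b | borders m b & [forall (e | e \in S :\ m), ~~ borders e b]].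

(* [move_value v' k] is v(G;m), where k boxes are claimed and v(G_m) = v'. *)
Definition move_value (v' : int) (k : nat) : int :=
  if (0 < k)%N then v' - k%:Z else - v'.

(* [n] is fuel; [value_at] supplies exactly the number of undrawn lines.
   The element [m0] only serves to start the minimum over the nonempty [S]. *)
Fixpoint value_rec (n : nat) S : int :=
  if n is n'.+1 then
    let w m := move_value (value_rec n' (S :\ m)) #|claimed S m| in
    if [pick m0 in S] is Some m0 then \big[Order.min/w m0]_(m in S) w m else 0
  else 0.

Definition value_at S : int := value_rec #|S| S.

Lemma value_at0 : value_at set0 = 0.
Proof. by rewrite /value_at cards0. Qed.

Lemma value_atP S : S != set0 ->
  let w m := move_value (value_at (S :\ m)) #|claimed S m| in
  (forall m, m \in S -> value_at S <= w m) /\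
  (exists2 m, m \in S & value_at S = w m).
Proof.
move=> S0 w.
have vE : exists2 m0, m0 \in S &
    value_at S = \big[Order.min/w m0]_(m in S) w m.
  have [m1 m1S] := set0Pn _ S0.
  have wE n m : #|S| = n.+1 -> m \in S ->
      move_value (value_rec n (S :\ m)) #|claimed S m| = w m.
    by move=> Sn mS; rewrite /w /value_at; move: Sn; rewrite (cardsD1 m) mS => -[<-].
  rewrite /value_at; case En: #|S| => [|n] /=.
    by move: S0; rewrite -cards_eq0 En.
  case: pickP => [m0 m0S | /(_ m1)]; last by rewrite m1S.
  exists m0 => //; rewrite (wE n m0) //.
  by apply: eq_bigr => m mS; rewrite wE.
case: vE => m0 m0S ->; split=> [m mS|].
  by rewrite (bigD1 m mS) /= ge_min lexx.
elim/big_ind: _ => [|x y [m mS ->] [m' m'S ->]|m mS]; first by exists m0.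
  by case: (leP (w m) (w m')) => _; [exists m | exists m'].
by exists m.
Qed.

End Value.

Definition value (G : board) : int := value_at [set: line G].

(* 0-based: box [i] is b_(i+1) and line [i] is e_i. *)
Definition chain (n : nat) : board :=
  @Board 'I_n 'I_n.+1 (fun e b => (e == b :> nat) || (e == b.+1 :> nat)).

Definition loop (n : nat) : board :=
  @Board 'I_n 'I_n (fun e b => (b == e) || (b == ordS e)).

Definition empty_board : board := @Board void void (fun _ _ => false).

Definition disjoint_union (G H : board) : board :=
  @Board (box G + box H)%type (line G + line H)%type
    (fun e b => match e, b with
                | inl e, inl b => borders e b
                | inr e, inr b => borders e b
                | _, _ => false
                end).

Definition endgame_board (cs ls : seq nat) : board :=
  foldr disjoint_union empty_board (map chain cs ++ map loop ls).

(* [cs] and [ls] list the lengths of the chains and of the loops of [G], with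
   multiplicity; they are determined by [G] up to order. *)
Definition simple_loony_endgame (G : board) (cs ls : seq nat) : Prop :=
  [/\ all (fun c => 3 <= c)%N cs,
      all (fun l => (4 <= l)%N && ~~ odd l) ls &
      board_iso G (endgame_board cs ls)].

Lemma is_position_disjoint_union (G H : board) :
  is_position G -> is_position H -> is_position (disjoint_union G H).
Proof.
move=> [Ge Gb] [He Hb].
have El (A B : finType) (p : pred (A + B)) : (forall b, ~~ p (inr b)) ->
    #|[set x | p x]| = #|[set a | p (inl a)]|.
  move=> pr; rewrite -(card_imset _ (@inl_inj A B)); apply: eq_card => -[a|b].
    by rewrite mem_imset ?inE //; exact: inl_inj.
  by rewrite inE (negbTE (pr b)); apply/esym/imsetP => -[].
have Er (A B : finType) (p : pred (A + B)) : (forall a, ~~ p (inl a)) ->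
    #|[set x | p x]| = #|[set b | p (inr b)]|.
  move=> pl; rewrite -(card_imset _ (@inr_inj A B)); apply: eq_card => -[a|b].
    by rewrite inE (negbTE (pl a)); apply/esym/imsetP => -[].
  by rewrite mem_imset ?inE //; exact: inr_inj.
by split=> -[x|x] /=; [rewrite El | rewrite Er | rewrite El | rewrite Er].
Qed.

Lemma is_position_chain n : (0 < n)%N -> is_position (chain n).
Proof.
case: n => // n _; split=> [e|b] /=.
  have ltn_e : (e.-1 < n.+1)%N by case: e => -[|e].
  apply/andP; split.
    apply/card_gt0P; exists (Ordinal ltn_e); rewrite inE /=.
    by case: e {ltn_e} => -[|e] //= _; rewrite eqxx orbT.
  have sub : [set b : 'I_n.+1 | (e == b :> nat) || (e == b.+1 :> nat)]
               \subset [set inord e; inord e.-1].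
    apply/subsetP => b; rewrite !inE => /orP[] /eqP ->.
      by rewrite inord_val eqxx.
    by rewrite /= inord_val eqxx orbT.
  by apply: leq_trans (subset_leq_card sub) _; rewrite cards2; case: eqP.
have -> : [set e : 'I_n.+2 | (e == b :> nat) || (e == b.+1 :> nat)]
            = [set widen_ord (leqnSn _) b; lift ord0 b].
  by apply/setP => e; rewrite !inE -!val_eqE.
by rewrite cards2; case: eqP.
Qed.

Lemma is_position_loop n : is_position (loop n).
Proof.
split=> [e|b] /=.
  have -> : [set b | (b == e) || (b == ordS e)] = [set e; ordS e].
    by apply/setP => b; rewrite !inE.
  by rewrite cards2; case: eqP.
have -> : [set e | (b == e) || (b == ordS e)] = [set b; ord_pred b].
  apply/setP => e; rewrite !inE (eq_sym b e); congr (_ || _).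
  by apply/eqP/eqP => [->|->]; rewrite ?ordSK ?ord_predK.
by rewrite cards2; case: eqP.
Qed.

Lemma is_position_endgame (cs ls : seq nat) :
  all (fun c => 3 <= c)%N cs -> is_position (endgame_board cs ls).
Proof.
rewrite /endgame_board; elim: cs => [_|c cs IH /= /andP[c3 /IH cs3]] /=.
  elim: ls => [|l ls IH] /=; first by split=> -[].
  exact: is_position_disjoint_union (is_position_loop l) IH.
by apply: is_position_disjoint_union cs3; apply: is_position_chain; case: c c3.
Qed.

Definition fcv (cs ls : seq nat) : int :=
  \sum_(c <- cs) (c%:Z - 4) + \sum_(l <- ls) (l%:Z - 8).

Definition tb (cs ls : seq nat) : int :=
  if nilp cs && nilp ls then 0
  else if has (fun c => 4 <= c)%N cs || nilp ls then 4
  else if nilp cs then 8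
  else 6.

Definition cv (cs ls : seq nat) : int := fcv cs ls + tb cs ls.

(* Main.v *)
(* If the opponent opens a component, the player to move can either take all of
   it, or take all but c boxes (c = 2 for a chain, 4 for a loop) and leave these
   as dominoes, which it is optimal to take at once. Nothing does better, and
   opening a chain in the middle does not help the opener, so
   v(G) = min over components of (n - c + |v(G minus the component) - c|).
   The rest is arithmetic with this recursion: v >= cv always; cv >= 2 implies
   v = cv by opening a suitable component; cv < 2 implies v <= 4, and v <= 3 if
   there is a 3-chain. Hence with a 3-chain and even cv < 2, opening it shows
   v <= 2, and v = 0 only if a 4-loop can be opened leaving value 4. For odd
   cv < 2 open a 3-chain, or a 4-loop if this would leave the exceptional value 0. *)
Require Import Defs.
From mathcomp Require Import all_boot all_order all_algebra.
From mathcomp Require Import zify.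

Set Implicit Arguments.
Unset Strict Implicit.
Unset Printing Implicit Defensive.

Import Order.TTheory GRing.Theory Num.Theory.

Local Open Scope ring_scope.

(** * Unclaimed boxes and the effect of one move on the value *)

Definition bordered (G : board) (S : {set line G}) : {set box G} :=
  [set b | [exists e in S, borders e b]].

Lemma claimedP (G : board) (S : {set line G}) m b :
  reflect (borders m b /\ forall e, e \in S -> borders e b -> e = m)
          (b \in claimed S m).
Proof.
rewrite inE; apply: (iffP andP) => -[mb H]; split=> //.
  move=> e eS eb; apply/eqP/negPn/negP => em.
  by move/forall_inP: H => /(_ e); rewrite !inE em eS eb => /(_ isT).
by apply/forall_inP => e; rewrite !inE => /andP[em /H eS]; apply: contra em => /eS ->.
Qed.

(** A box ceases to be unclaimed exactly when its last undrawn line goes, that is, when it is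
    claimed. Scores below are read off as differences of [#|bordered S|]. *)
Lemma card_bordered_rem (G : board) (S : {set line G}) m : m \in S ->
  #|bordered S| = (#|bordered (S :\ m)| + #|claimed S m|)%N.
Proof.
move=> mS; rewrite -(cardsID (claimed S m) (bordered S)) addnC; congr (_ + _)%N.
  apply: eq_card => b; rewrite in_setD; apply/andP/idP.
    move=> [nc]; rewrite !inE => /exists_inP[e eS eb]; apply/exists_inP.
    have [em|em] := eqVneq e m; last by exists e; rewrite // !inE em.
    subst e; move: nc; rewrite inE eb /= => /forall_inPn[e' e'S /negPn e'b].
    by exists e'.
  rewrite !inE => /exists_inP[e]; rewrite !inE => /andP[em eS] eb; split.
    by apply/negP => /andP[_ /forall_inP/(_ e)]; rewrite !inE em eS eb => /(_ isT).
  by apply/exists_inP; exists e.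
apply: eq_card => b; rewrite in_setI andbC; case: (boolP (b \in claimed S m)) => //=.
by move=> /claimedP[mb _]; rewrite inE; apply/exists_inP; exists m.
Qed.

Lemma bordered0 (G : board) : bordered (set0 : {set line G}) = set0.
Proof. by apply/setP => b; rewrite !inE; apply/exists_inP => -[e]; rewrite inE. Qed.

Lemma sub_claimed (G : board) (S D : {set line G}) m :
  S \subset D -> claimed D m \subset claimed S m.
Proof.
move=> /subsetP SD; apply/subsetP => b /claimedP[mb H]; apply/claimedP.
by split=> // e /SD; apply: H.
Qed.

Lemma value_capture (G : board) (S : {set line G}) m :
    m \in S -> claimed S m != set0 ->
  value_at S <= value_at (S :\ m) - #|claimed S m|%:Z.
Proof.
move=> mS; rewrite -card_gt0 => c0.
have /value_atP[/(_ m mS)] : S != set0 by apply/set0Pn; exists m.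
by rewrite /move_value c0.
Qed.

Lemma value_quiet (G : board) (S : {set line G}) m :
  m \in S -> claimed S m = set0 -> value_at S <= - value_at (S :\ m).
Proof.
move=> mS c0; have /value_atP[/(_ m mS)] : S != set0 by apply/set0Pn; exists m.
by rewrite /move_value c0 cards0.
Qed.

Lemma value_optimal (G : board) (S : {set line G}) : S != set0 ->
  exists2 m, m \in S &
    if claimed S m == set0 then value_at S = - value_at (S :\ m)
    else value_at S = value_at (S :\ m) - #|claimed S m|%:Z.
Proof.
move=> /value_atP[_ [m mS ->]]; exists m => //.
by case: eqVneq => [->|]; rewrite /move_value ?cards0 // -card_gt0 => ->.
Qed.

(** * Invariance of the value under isomorphism *)

Definition is_iso (G H : board) (f : box G -> box H) (g : line G -> line H) :=
  [/\ bijective f, bijective g & forall e b, borders (g e) (f b) = borders e b].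

Lemma claimed_iso (G H : board) f g (S : {set line G}) m : @is_iso G H f g ->
  claimed (g @: S) (g m) = f @: claimed S m.
Proof.
move=> [[f' fK f'K] [g' gK g'K] fg]; apply/setP => b; rewrite -[b]f'K.
rewrite (mem_imset _ _ (can_inj fK)); set b' := f' b.
apply/claimedP/claimedP; rewrite fg => -[mb Hb]; split=> // e.
  by move=> eS eb; apply: (can_inj gK); apply: Hb; rewrite ?fg ?imset_f.
by move=> /imsetP[e' e'S ->]; rewrite fg => /(Hb _ e'S) ->.
Qed.

Lemma imsetD1_inj (A B : finType) (g : A -> B) (S : {set A}) m :
  injective g -> g @: (S :\ m) = (g @: S) :\ g m.
Proof.
move=> gI; apply/setP => x; apply/imsetP/idP.
  by move=> [y]; rewrite !inE => /andP[ym yS] ->; rewrite (inj_eq gI) ym imset_f.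
rewrite !inE => /andP[xm /imsetP[y yS xy]]; exists y => //; subst x.
by rewrite !inE yS andbT; apply: contra xm => /eqP ->.
Qed.

Lemma value_iso (G H : board) f g (S : {set line G}) : @is_iso G H f g ->
  value_at (g @: S) = value_at S.
Proof.
move=> fg; have [fI gI] : injective f /\ injective g by case: fg => /bij_inj ? /bij_inj.
have [n] := ubnP #|S|; elim: n S => // n IH S; rewrite ltnS => Sn.
have [->|S0] := eqVneq S set0; first by rewrite imset0 !value_at0.
have IHm m : m \in S -> value_at (g @: S :\ g m) = value_at (S :\ m).
  by move=> mS; rewrite -imsetD1_inj // IH //; move: Sn; rewrite (cardsD1 m S) mS.
have cE m : claimed (g @: S) (g m) = f @: claimed S m by apply: claimed_iso.
have gS0 : g @: S != set0 by rewrite imset_eq0.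
apply/eqP; rewrite eq_le; apply/andP; split.
  have [m mS] := value_optimal S0; case: eqVneq => [c0|c0] ->.
    by rewrite -IHm //; apply: value_quiet; rewrite ?imset_f // cE c0 imset0.
  rewrite -IHm // -(card_imset _ fI) -cE; apply: value_capture; first by rewrite imset_f.
  by rewrite cE imset_eq0.
have [gm /imsetP[m mS ->]] := value_optimal gS0; rewrite cE imset_eq0 IHm //.
by rewrite (card_imset _ fI); case: eqVneq => c0 ->; [exact: value_quiet|exact: value_capture].
Qed.

(** * Positions on a disjoint union of two boards *)

Section Union.

Context {A B : board}.
Implicit Types (T : {set line A}) (H : {set line B}).

Definition union_lines T H : {set line (disjoint_union A B)} :=
  [set x : line A + line B | match x with inl a => a \in T | inr b => b \in H end].

Definition union_value T H : int := value_at (union_lines T H).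

Lemma union_linesDl T H m :
  union_lines T H :\ (inl m : line (disjoint_union A B)) = union_lines (T :\ m) H.
Proof. by apply/setP => -[a|b]; rewrite !inE. Qed.

Lemma union_linesDr T H m :
  union_lines T H :\ (inr m : line (disjoint_union A B)) = union_lines T (H :\ m).
Proof. by apply/setP => -[a|b]; rewrite !inE. Qed.

Lemma claimed_unionl T H m :
  claimed (union_lines T H) (inl m : line (disjoint_union A B)) = inl @: claimed T m.
Proof.
apply/setP => -[b|b]; last first.
  by apply/claimedP/imsetP => -[].
rewrite (mem_imset _ _ inl_inj); apply/claimedP/claimedP => -[mb Hb]; split=> //.
  by move=> e eT eb; apply: (@inl_inj _ (line B)); apply: Hb; rewrite ?inE.
by move=> [e|e]; rewrite inE //= => eT /(Hb _ eT) ->.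
Qed.

Lemma claimed_unionr T H m :
  claimed (union_lines T H) (inr m : line (disjoint_union A B)) = inr @: claimed H m.
Proof.
apply/setP => -[b|b].
  by apply/claimedP/imsetP => -[].
rewrite (mem_imset _ _ inr_inj); apply/claimedP/claimedP => -[mb Hb]; split=> //.
  by move=> e eT eb; apply: (@inr_inj (line A) _); apply: Hb; rewrite ?inE.
by move=> [e|e]; rewrite inE //= => eT /(Hb _ eT) ->.
Qed.

Lemma union_capture T H m : m \in T -> claimed T m != set0 ->
  union_value T H <= union_value (T :\ m) H - #|claimed T m|%:Z.
Proof.
move=> mT c0; rewrite -(card_imset _ (@inl_inj _ (box B))) -(claimed_unionl _ H).
rewrite /union_value -union_linesDl; apply: value_capture; first by rewrite inE.
by rewrite claimed_unionl imset_eq0.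
Qed.

Lemma union_quiet T H m : m \in T -> claimed T m = set0 ->
  union_value T H <= - union_value (T :\ m) H.
Proof.
move=> mT c0; rewrite /union_value -union_linesDl; apply: value_quiet.
  by rewrite inE.
by rewrite claimed_unionl c0 imset0.
Qed.

Lemma union_optimal T H : (T != set0) || (H != set0) ->
  (exists2 m, m \in T &
    if claimed T m == set0 then union_value T H = - union_value (T :\ m) H
    else union_value T H = union_value (T :\ m) H - #|claimed T m|%:Z) \/
  (exists2 m, m \in H &
    if claimed H m == set0 then union_value T H = - union_value T (H :\ m)
    else union_value T H = union_value T (H :\ m) - #|claimed H m|%:Z).
Proof.
move=> TH; have : union_lines T H != set0.
  by case/orP: TH => /set0Pn[m mS]; apply/set0Pn; [exists (inl m)|exists (inr m)]; rewrite inE.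
move=> /value_optimal[[m|m]]; rewrite inE => mS.
  rewrite claimed_unionl imset_eq0 union_linesDl (card_imset _ inl_inj).
  by left; exists m.
rewrite claimed_unionr imset_eq0 union_linesDr (card_imset _ inr_inj).
by right; exists m.
Qed.

Lemma union_value0 H : union_value set0 H = value_at H.
Proof.
have [n] := ubnP #|H|; elim: n H => // n IH H; rewrite ltnS => Hn.
have [->|H0] := eqVneq H set0.
  rewrite value_at0 /union_value (_ : union_lines _ _ = set0) ?value_at0 //.
  by apply/setP => -[x|x]; rewrite !inE.
have IHm m : m \in H -> union_value set0 (H :\ m) = value_at (H :\ m).
  by move=> mH; apply: IH; move: Hn; rewrite (cardsD1 m H) mH.
apply/eqP; rewrite eq_le; apply/andP; split.
  have [m mH] := value_optimal H0; rewrite -IHm //.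
  have mU : (inr m : line (disjoint_union A B)) \in union_lines set0 H by rewrite inE.
  case: eqVneq => c0 ->.
    rewrite /union_value -union_linesDr; apply: value_quiet => //.
    by rewrite claimed_unionr c0 imset0.
  rewrite -(card_imset _ (@inr_inj (box A) _)) -(claimed_unionr set0).
  rewrite /union_value -union_linesDr; apply: value_capture => //.
  by rewrite claimed_unionr imset_eq0.
case: (@union_optimal set0 H); rewrite ?H0 ?orbT // => -[m mH]; first by rewrite inE in mH.
by rewrite IHm //; case: eqVneq => c0 ->; [exact: value_quiet|exact: value_capture].
Qed.

End Union.

(** * Opening a loony component: take everything or keep control *)

Definition quiet_board (G : board) :=
  forall m : line G, claimed [set: line G] m = set0.

(* In [loony_control], [m] opens the component; the opponent captures boxes
   until only the lines of [D] remain, and then draws [e] to keep control. *)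
Record loony_component (A : board) (c : nat) : Prop := LoonyComponent {
  loony_line : [set: line A] != set0;
  loony_quiet : quiet_board A;
  loony_bordered : bordered [set: line A] = [set: box A];
  loony_capture : forall T : {set line A}, T != set0 -> T != setT ->
    exists2 m, m \in T & claimed T m != set0;
  loony_quiet_card : forall (T : {set line A}) m, T != setT -> m \in T ->
    claimed T m = set0 -> (c <= #|bordered T|)%N;
  loony_control : forall m : line A, exists (D : {set line A}) (e : line A),
    [/\ D \subset [set~ m], (#|bordered D| <= c)%N, e \in D /\ claimed D e = set0,
        forall a, a \in D :\ e -> claimed (D :\ e) a != set0
      & forall T : {set line A}, D \subset T -> T != D -> m \notin T ->
          exists2 a, a \in T :\: D & claimed T a != set0]
}.

Section Component.

Context {A B : board} {c : nat} (Ac : loony_component A c).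
Implicit Types (m : line A) (T D S : {set line A}) (H : {set line B}).

(** The mover captures lines outside [D] one after another without losing the turn. The value is the
    score of the other player, so each box claimed on the way lowers it by one. *)
Lemma union_take_down T D H :
    D \subset T ->
    (forall S, D \subset S -> S \subset T -> S != D ->
       exists2 a, a \in S :\: D & claimed S a != set0) ->
  union_value T H <= union_value D H + #|bordered D|%:Z - #|bordered T|%:Z.
Proof.
have [n] := ubnP #|T|; elim: n T => // n IH T; rewrite ltnS => Tn DT step.
have [->|TD] := eqVneq T D; first by rewrite addrK.
have [a] := step T DT (subxx _) TD; rewrite !inE => /andP[aD aT] c0.
apply: le_trans (union_capture H aT c0) _.
have : union_value (T :\ a) H
    <= union_value D H + #|bordered D|%:Z - #|bordered (T :\ a)|%:Z.
  apply: IH; first by move: Tn; rewrite (cardsD1 a T) aT.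
    by rewrite subsetD1 DT aD.
  by move=> S DS ST; apply: step => //; apply: subset_trans ST (subsetDl _ _).
by rewrite (card_bordered_rem aT); lia.
Qed.

Lemma union_take_all T H : T != setT ->
  union_value T H <= value_at H - #|bordered T|%:Z.
Proof.
move=> TT; have := @union_take_down T set0 H.
rewrite union_value0 bordered0 cards0 addr0; apply; first exact: sub0set.
move=> S _ ST S0; rewrite setD0; apply: (loony_capture Ac S0).
by apply: contra TT => /eqP SE; rewrite -subTset -SE.
Qed.

(** [D] stands for the dominoes left by the controlling player. The mover has nothing better than to
    take all of them and then start in [H]; this is the bound opposite to [union_take_all]. *)
Lemma union_all_capture D H : D != setT ->
    (forall a, a \in D -> claimed D a != set0) ->
  value_at H - #|bordered D|%:Z <= union_value D H.
Proof.
have [n] := ubnP (#|D| + #|H|)%N; elim: n D H => // n IH D H; rewrite ltnS => Dn DT cap.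
have [/andP[/eqP -> /eqP ->]|] := boolP ((D == set0) && (H == set0)).
  by rewrite union_value0 bordered0 cards0 subr0.
rewrite negb_and => /union_optimal[] [m mS].
  rewrite (negbTE (cap m mS)) => ->.
  have : value_at H - #|bordered (D :\ m)|%:Z <= union_value (D :\ m) H.
    apply: IH.
    - by move: Dn; rewrite (cardsD1 m D) mS.
    - by rewrite -subTset; apply: contra DT => /subset_trans/(_ (subsetDl _ _)); rewrite subTset.
    move=> a aD; have aD' : a \in D by move: aD; rewrite inE => /andP[].
    apply: contraNneq (cap a aD') => c0; rewrite -subset0 -c0.
    exact/sub_claimed/subsetDl.
  by rewrite (card_bordered_rem mS); lia.
have Hn : (#|D| + #|H :\ m| < n)%N by move: Dn; rewrite (cardsD1 m H) mS addnS.
(* A quiet move in [H] hands all of [D] to the opponent, which is no better than taking [D] before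
   making that move. *)
case: eqVneq => c0 ->.
  by have := union_take_all (H :\ m) DT; have := value_quiet mS c0; lia.
by have := IH _ _ Hn DT cap; have := value_capture mS c0; lia.
Qed.

(** The two terms are the scores of taking the whole opened component and of keeping control at the
    price of [c] boxes. No reply gives the mover more than the better of the two. *)
Lemma union_response T : quiet_board B -> T != setT ->
  Num.min (value_at [set: line B] - #|bordered T|%:Z)
          (c%:Z *+ 2 - #|bordered T|%:Z - value_at [set: line B])
    <= union_value T [set: line B].
Proof.
move=> qB; have [n] := ubnP #|T|; elim: n T => // n IH T; rewrite ltnS => Tn TT.
have [/andP[/eqP -> /eqP ->]|] := boolP ((T == set0) && ([set: line B] == set0)).
  by rewrite union_value0 bordered0 cards0 subr0 ge_min lexx.
have remT m : T :\ m != setT.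
  by rewrite -subTset; apply: contra TT => /subset_trans/(_ (subsetDl _ _)); rewrite subTset.
rewrite negb_and => /union_optimal[] [m mS].
  case: eqVneq => c0 ->.
    (* A quiet move inside the component leaves at least [c] boxes there, and the opponent can take
       them all, so it does no better than control. *)
    have := loony_quiet_card Ac TT mS c0.
    have := union_take_all [set: line B] (remT m).
    by rewrite (card_bordered_rem mS) c0 cards0; lia.
  have : (#|T :\ m| < n)%N by move: Tn; rewrite (cardsD1 m T) mS.
  by move=> /IH/(_ (remT m)); rewrite (card_bordered_rem mS); lia.
(* A move in [B] claims nothing and leaves the rest of the component to the opponent. *)
rewrite qB eqxx => ->; have := union_take_all ([set: line B] :\ m) TT.
by have := value_quiet mS (qB m); lia.
Qed.

(** The mover captures down to [D] and draws [e]. The opponent can do no better than take the at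
    most [c] boxes of [D], and must then start in [H]. *)
Lemma union_control m H :
  union_value [set~ m] H <= c%:Z *+ 2 - #|box A|%:Z - value_at H.
Proof.
have [D [e [Dm Dc [eD qe] capD step]]] := loony_control Ac m.
have mD : m \notin D by apply/negP => /(subsetP Dm); rewrite !inE eqxx.
have DeT : D :\ e != setT.
  by apply/eqP => /setP/(_ e); rewrite !inE eqxx.
have := union_all_capture H DeT capD.
have := union_quiet H eD qe.
have : union_value [set~ m] H
     <= union_value D H + #|bordered D|%:Z - #|bordered [set~ m]|%:Z.
  apply: union_take_down => // S DS Sm SD; apply: step => //.
  by apply/negP => /(subsetP Sm); rewrite !inE eqxx.
have := card_bordered_rem eD; rewrite qe cards0.
have := card_bordered_rem (in_setT m).
rewrite (loony_quiet Ac) cards0 (loony_bordered Ac) cardsT setTD; lia.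
Qed.

(** With n boxes in [A] and v the value of [B], the upper bounds from taking all and from control
    meet the lower bound of [union_response] at min(v - n, 2c - n - v) = c - n - |v - c|. *)
Lemma opening_value m : quiet_board B ->
  - union_value [set~ m] [set: line B]
    = #|box A|%:Z - c%:Z + `|value_at [set: line B] - c%:Z|.
Proof.
move=> qB; have mT : [set~ m] != [set: line A].
  by apply/eqP => /setP/(_ m); rewrite !inE eqxx.
have := union_control m [set: line B].
have := union_take_all [set: line B] mT.
have := union_response qB mT.
have := card_bordered_rem (in_setT m).
rewrite (loony_quiet Ac) cards0 (loony_bordered Ac) cardsT setTD; lia.
Qed.

End Component.

Lemma quiet_disjoint_union (A B : board) :
  quiet_board A -> quiet_board B -> quiet_board (disjoint_union A B).
Proof.
move=> qA qB; rewrite /quiet_board.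
have -> : [set: line (disjoint_union A B)] = union_lines setT setT.
  by apply/setP => -[x|x]; rewrite !inE.
move=> [m|m]; first by rewrite claimed_unionl qA imset0.
by rewrite claimed_unionr qB imset0.
Qed.

(** A discrete intermediate value argument. It locates an undrawn line next to a drawn one, where a
    box can be captured. *)
Lemma switch_between (P : pred nat) i j : (i <= j)%N -> P i != P j ->
  exists k, (i <= k < j)%N /\ P k != P k.+1.
Proof.
elim: j => [|j IH]; first by rewrite leqn0 => /eqP ->; rewrite eqxx.
rewrite leq_eqVlt => /orP[/eqP ->|ij]; first by rewrite eqxx.
have [Pij|Pij _] := eqVneq (P i) (P j).
  by rewrite Pij => Pj; exists j; rewrite leqnn -ltnS ij.
have [k [/andP[ik kj] Pk]] := IH ij Pij.
by exists k; rewrite ik ltnW.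
Qed.

(** * Chains are loony components of control cost 2 *)

Section Chain.

Context (n : nat).
Implicit Types (T : {set line (chain n)}) (e p q : line (chain n)) (b : box (chain n)).

Lemma chain_claimed T e b : borders e b ->
    (forall p, p \in T -> (p == b :> nat) || (p == b.+1 :> nat) -> p = e :> nat) ->
  b \in claimed T e.
Proof. by move=> eb H; apply/claimedP; split=> // p pT pb; apply/val_inj/H. Qed.

(** Somewhere between an undrawn and a drawn line two consecutive lines differ, and the box between
    them has one undrawn line left. The bounds on [a] later keep the capture away from a reserved
    domino. *)
Lemma chain_capture T p q : p \in T -> q \notin T ->
  exists2 a, a \in T & (minn p q <= a <= maxn p q)%N /\ claimed T a != set0.
Proof.
(* [inord] lets the index run over the naturals. Only indices at most [n] matter, so its default
   value is never met. *)
move=> pT qT; pose P k := (inord k : 'I_n.+1) \in T.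
have PE (e : 'I_n.+1) : P e = (e \in T) by rewrite /P inord_val.
have : P (minn p q) != P (maxn p q).
  by case: (leqP p q) => _; rewrite !PE pT (negbTE qT).
case/switch_between => [|k [/andP[ik kj]]]; first by rewrite geq_min leq_max leqnn.
have kn : (k < n)%N by have := ltn_ord p; have := ltn_ord q; lia.
rewrite /P; set e0 := inord k; set e1 := inord k.+1.
have e0E : e0 = k :> nat by rewrite inordK // ltnW.
have e1E : e1 = k.+1 :> nat by rewrite inordK.
pose b : box (chain n) := Ordinal kn.
have e01 e : (e == b :> nat) || (e == b.+1 :> nat) -> e = e0 \/ e = e1.
  by case/orP => /eqP eb; [left|right]; apply/val_inj; rewrite /= ?e0E ?e1E.
case: (boolP (e0 \in T)) => e0T; case: (boolP (e1 \in T)) => e1T // _.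
  exists e0 => //; split; first by lia.
  apply/set0Pn; exists b; apply: chain_claimed; first by rewrite /= e0E eqxx.
  by move=> e eT /e01[->//|eE]; move: e1T; rewrite -eE eT.
exists e1 => //; split; first by lia.
apply/set0Pn; exists b; apply: chain_claimed; first by rewrite /= e1E eqxx orbT.
by move=> e eT /e01[eE|->//]; move: e0T; rewrite -eE eT.
Qed.

Lemma chain_quiet T e b : claimed T e = set0 -> borders e b ->
  exists2 p, p \in T & p != e /\ ((p == b :> nat) || (p == b.+1 :> nat)).
Proof.
move=> c0 eb; case: (pickP [pred p in T | (p != e) && borders p b]) => [p|none].
  by move=> /andP[pT /andP[pe pb]]; exists p.
suff : b \in claimed T e by rewrite c0 inE.
apply/claimedP; split=> // p pT pb; apply/eqP/negPn/negP => pe.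
by have := none p; rewrite inE pT pe pb.
Qed.

(** Intended for an end line [x], the next line [y] and the two boxes [z], [w] at that end. Drawing
    [x] last leaves [y] alone as a domino. The final hypothesis keeps captures between [m] and any
    other line away from this pair. *)
Lemma chain_control (x y m : line (chain n)) (z w : box (chain n)) :
    x != y -> m != x -> m != y ->
    (forall b, borders x b -> b = z) ->
    borders y z -> (forall b, borders y b -> b = z \/ b = w) ->
    (forall a p : line (chain n), p != x -> p != y ->
       (minn p m <= a <= maxn p m)%N -> a != x /\ a != y) ->
  exists (D : {set line (chain n)}) (e : line (chain n)),
    [/\ D \subset [set~ m], (#|bordered D| <= 2)%N, e \in D /\ claimed D e = set0,
        forall a, a \in D :\ e -> claimed (D :\ e) a != set0
      & forall T : {set line (chain n)}, D \subset T -> T != D -> m \notin T ->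
          exists2 a, a \in T :\: D & claimed T a != set0].
Proof.
move=> xy mx my xz yz yw sep; exists [set x; y], x; split.
- by apply/subsetP => a; rewrite !inE => /orP[]/eqP ->; rewrite eq_sym.
- have /subset_leq_card/leq_trans -> // : bordered [set x; y] \subset [set z; w].
    apply/subsetP => b; rewrite !inE => /exists_inP[e]; rewrite !inE => /orP[]/eqP ->.
      by move=> /xz ->; rewrite eqxx.
    by case/yw => ->; rewrite eqxx ?orbT.
  by rewrite cards2; case: eqP.
- split; first by rewrite !inE eqxx.
  apply/setP => b; rewrite in_set0; apply/claimedP => -[/xz -> /(_ y)].
  by rewrite !inE eqxx orbT => /(_ isT yz) yx; rewrite yx eqxx in xy.
- move=> a; rewrite !inE => /andP[ax /orP[|/eqP ->]]; first by rewrite (negbTE ax).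
  apply/set0Pn; exists z. apply/claimedP; split=> // e.
  by rewrite !inE => /andP[/negbTE ->] /eqP.
move=> T DT TD mT; have [p pT pD] : exists2 p, p \in T & p \notin [set x; y].
  by apply/subsetPn; apply: contra TD => TD; rewrite eqEsubset TD DT.
have [a aT [amp ca]] := chain_capture pT mT; exists a => //.
move: pD; rewrite !inE negb_or aT andbT => /andP[px py].
by rewrite negb_or; apply/andP; apply: (sep a p).
Qed.

Lemma chain_loony : (3 <= n)%N -> loony_component (chain n) 2.
Proof.
move=> n3.
have quiet : quiet_board (chain n).
  move=> m; apply/setP => b; rewrite in_set0; apply/claimedP => -[mb Hb].
  have b0 : (widen_ord (leqnSn n) b : line (chain n)) = m by apply: Hb; rewrite ?inE //= eqxx.
  have b1 : (lift ord0 b : line (chain n)) = m by apply: Hb; rewrite ?inE //= eqxx orbT.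
  by have /(congr1 val)/= := etrans b0 (esym b1); rewrite /bump /=; lia.
have in_bordered T e (b : box (chain n)) : e \in T -> (e == b :> nat) || (e == b.+1 :> nat) ->
  b \in bordered T by move=> eT eb; rewrite inE; apply/exists_inP; exists e.
split=> //.
- by apply/set0Pn; exists ord0; rewrite inE.
- apply/setP => b; rewrite [RHS]inE.
  by apply: (in_bordered _ (widen_ord (leqnSn n) b)); rewrite ?inE //= eqxx.
- move=> T /set0Pn[p pT]; rewrite -subTset => /subsetPn[q _ qT].
  by have [a aT [_ ca]] := chain_capture pT qT; exists a.
- move=> T m _ mT c0.
  (* Since [m] is quiet it has an undrawn neighbour. One of these two lines is not an end line of
     the chain, and so borders two consecutive boxes. *)
  suff [k kn [kT k1T]] : exists2 k, (k.+1 < n)%N &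
      (forall b : box (chain n), b = k :> nat -> b \in bordered T) /\
      (forall b : box (chain n), b = k.+1 :> nat -> b \in bordered T).
    pose b : box (chain n) := Ordinal (ltnW kn); pose b' : box (chain n) := Ordinal kn.
    have bb' : b != b' by apply/eqP => /(congr1 val)/= ?; lia.
    have <- : #|[set b; b']| = 2%N by rewrite cards2 bb'.
    by apply/subset_leq_card/subsetP => x /set2P[] ->; [apply: kT|apply: k1T].
  have mn : (m <= n)%N by rewrite -ltnS ltn_ord.
  have [mn1|mn1] := ltnP m n; last first.
    have bn : (n.-1 < n)%N by lia.
    pose b : box (chain n) := Ordinal bn.
    have mb : borders m b by rewrite /= /b /=; lia.
    have [p pT [/eqP pm pb]] := chain_quiet c0 mb.
    have pE : p = n.-1 :> nat.
      by have : (p : nat) <> m by [move/val_inj]; move: pb; rewrite /=; lia.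
    exists n.-2; first by lia.
    by split=> b' b'E; apply: (in_bordered _ p) => //; rewrite pE b'E; lia.
  pose b : box (chain n) := Ordinal mn1.
  have mb : borders m b by rewrite /= eqxx.
  have [p pT [/eqP pm pb]] := chain_quiet c0 mb.
  have pE : p = m.+1 :> nat.
    by have : (p : nat) <> m by [move/val_inj]; move: pb; rewrite /=; lia.
  have [mn2|mn2] := ltnP m.+1 n.
    exists m => //.
    by split=> b' b'E; apply: (in_bordered _ p) => //; rewrite pE b'E; lia.
  exists m.-1; first by lia.
  by split=> b' b'E; apply: (in_bordered _ m) => //; rewrite b'E; lia.
move=> m; have n0 : (0 < n)%N by lia.
have n1 : (1 < n)%N by lia.
have nn : (n.-1 < n)%N by lia.
have nn2 : (n.-2 < n)%N by lia.
have [m2|m2] := ltnP m 2.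
  apply: (@chain_control ord_max (inord n.-1) m (Ordinal nn) (Ordinal nn2));
    rewrite -?val_eqE /= ?inordK; try lia.
  + by move=> b /orP[]/eqP bE; apply/val_inj; have := ltn_ord b; rewrite /=; lia.
  + by move=> b /orP[]/eqP bE; [left|right]; apply/val_inj; rewrite /=; lia.
  by move=> a p; rewrite -!val_eqE /= ?inordK; have := ltn_ord p; lia.
apply: (@chain_control ord0 (inord 1) m (Ordinal n0) (Ordinal n1));
  rewrite -?val_eqE /= ?inordK; try lia.
+ by move=> b /orP[]/eqP bE; apply/val_inj; rewrite /=; lia.
+ by move=> b /orP[]/eqP bE; [right|left]; apply/val_inj; rewrite /=; lia.
by move=> a p; rewrite -!val_eqE /= ?inordK; lia.
Qed.

End Chain.

(** * Loops are loony components of control cost 4 *)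

Section Loop.

Context (n : nat).
Implicit Types (T : {set line (loop n)}) (m e p q : line (loop n)) (b : box (loop n)).

(** Lines and boxes of a loop share the index type ['I_n], so [turn] serves for both. The box
    [turn m k.+1] lies between the lines [turn m k] and [turn m k.+1]. *)
Definition turn (m : 'I_n) k : 'I_n := iter k (@ordS n) m.

Lemma val_turn (m : 'I_n) k : turn m k = ((m + k) %% n)%N :> nat.
Proof.
elim: k => [|k IH]; first by rewrite addn0 modn_small.
by rewrite /turn iterS /= -/(turn m k) IH addnS -addn1 modnDml addn1.
Qed.

Lemma turn_inj (m : 'I_n) i j : (i < j)%N -> (j < i + n)%N -> turn m i != turn m j.
Proof.
move=> ij jin; apply/eqP => /(congr1 val); rewrite /= !val_turn => /eqP.
rewrite eqn_modDl eq_sym eqn_mod_dvd ?(ltnW ij) // => /dvdn_leq; lia.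
Qed.

Lemma turn_surj (m p : 'I_n) : exists2 k, (k < n)%N & p = turn m k.
Proof.
have n0 : (0 < n)%N by case: m => k /(leq_ltn_trans _) ->.
exists ((p + n - m) %% n)%N; first by rewrite ltn_mod.
apply/val_inj; rewrite /= val_turn modnDmr addnC subnK ?modnDr ?modn_small //.
by have := ltn_ord m; lia.
Qed.

Lemma turnn (m : 'I_n) : turn m n = m.
Proof. by apply/val_inj; rewrite /= val_turn modnDr modn_small. Qed.

Lemma loop_borders_turn (m : 'I_n) k (e : line (loop n)) :
  borders e (turn m k.+1 : box (loop n)) -> e = turn m k \/ e = turn m k.+1.
Proof.
case/orP => /eqP; first by right.
by rewrite /turn iterS -/(turn m k) => /(bij_inj (Bijective (@ordSK n) (@ord_predK n))); left.
Qed.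

Lemma loop_claimed_turn T m k e :
    e = turn m k \/ e = turn m k.+1 ->
    (forall p, p \in T -> p = turn m k \/ p = turn m k.+1 -> p = e) ->
  (turn m k.+1 : box (loop n)) \in claimed T e.
Proof.
move=> ek H; apply/claimedP; split.
  by case: ek => ->; rewrite /= eqxx ?orbT.
by move=> p pT /loop_borders_turn; apply: H.
Qed.

Lemma loop_capture T m i j : (i <= j)%N ->
    (turn m i \in T) != (turn m j \in T) ->
  exists2 k, (i <= k <= j)%N & turn m k \in T /\ claimed T (turn m k) != set0.
Proof.
move=> ij; case/(switch_between (P := fun k => turn m k \in T) ij) => k [/andP[ik kj]].
case: (boolP (turn m k \in T)) => kT; case: (boolP (turn m k.+1 \in T)) => k1T // _.
  exists k; rewrite ?ik ?(ltnW kj) //; split=> //; apply/set0Pn.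
  exists (turn m k.+1); apply: loop_claimed_turn; first by left.
  by move=> p pT [->//|pk]; rewrite -pk pT in k1T.
exists k.+1; rewrite ?kj ?(leqW ik) //; split=> //; apply/set0Pn.
exists (turn m k.+1); apply: loop_claimed_turn; first by right.
by move=> p pT [pk|->//]; rewrite -pk pT in kT.
Qed.

Lemma loop_quiet_turn T m k e :
    claimed T e = set0 -> e = turn m k \/ e = turn m k.+1 ->
  exists2 p, p \in T & p != e /\ (p = turn m k \/ p = turn m k.+1).
Proof.
move=> c0 ek; pose b : box (loop n) := turn m k.+1.
case: (pickP [pred p in T | (p != e) && borders p b]) => [p|none].
  by move=> /andP[pT /andP[pe /loop_borders_turn pb]]; exists p.
suff : b \in claimed T e by rewrite c0 in_set0.
apply: loop_claimed_turn => // p pT pk; apply/eqP/negPn/negP => pe.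
have := none p; rewrite inE pT pe /=.
by case: pk => ->; rewrite eqxx ?orbT.
Qed.

Lemma loop_loony : (4 <= n)%N -> loony_component (loop n) 4.
Proof.
move=> n4; have turn1 m k : turn m k != turn m k.+1 by apply: turn_inj; lia.
have pred_turn (m : 'I_n) : m = turn (ord_pred m) 1 by rewrite /turn /= ord_predK.
have in_bordered T m k : (turn m k \in T) || (turn m k.+1 \in T) ->
    (turn m k.+1 : box (loop n)) \in bordered T.
  by move=> /orP[] eT; rewrite inE; apply/exists_inP;
     [exists (turn m k)|exists (turn m k.+1)] => //=; rewrite eqxx ?orbT.
split=> //.
- have n0 : (0 < n)%N by lia.
  by apply/set0Pn; exists (Ordinal n0); rewrite inE.
- move=> m; apply/setP => b; rewrite in_set0; apply/negP => /claimedP[].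
  have [k _ ->] := turn_surj (ordS m) b.
  rewrite /turn -iterSr -/(turn m k.+1) => /loop_borders_turn mk Hm.
  have H1 : (turn m k : line (loop n)) = m.
    by apply: Hm; rewrite ?in_setT //= eqxx orbT.
  have H2 : (turn m k.+1 : line (loop n)) = m by apply: Hm; rewrite ?in_setT //= eqxx.
  by have := turn1 m k; rewrite H1 H2 eqxx.
- apply/setP => b; rewrite [RHS]inE (pred_turn b).
  by apply: in_bordered; rewrite !inE.
- move=> T /set0Pn[p pT]; rewrite -subTset => /subsetPn[q _ qT].
  have [k kn pk] := turn_surj q p.
  have : (turn q 0 \in T) != (turn q k \in T) by rewrite -pk pT (negbTE qT).
  by case/loop_capture => // j _ [jT cj]; exists (turn q j).
- move=> T m _ mT c0; pose r : 'I_n := ord_pred m.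
  have mr : m = turn r 1 by apply: pred_turn.
  have r0T : turn r 0 \in T.
    have [|p pT [/eqP pm []]] := @loop_quiet_turn T r 0 m c0; first by right.
      by move=> <-.
    by rewrite -mr => pm'; case: pm.
  have r2T : turn r 2 \in T.
    have [|p pT [/eqP pm []]] := @loop_quiet_turn T r 1 m c0; first by left.
      by rewrite -mr => pm'; case: pm.
    by move=> <-.
  rewrite mr in mT.
  have bT k : (k < 4)%N -> (turn r k : box (loop n)) \in bordered T.
    case: k => [|[|[|[|]]]] // _; last 3 first.
    - by apply: in_bordered; rewrite r0T.
    - by apply: in_bordered; rewrite r2T orbT.
    - by apply: in_bordered; rewrite r2T.
    by rewrite inE; apply/exists_inP; exists (turn r 0) => //=; rewrite eqxx.
  have u : uniq [seq turn r k | k <- iota 0 4].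
    by rewrite map_inj_in_uniq ?iota_uniq // => i j; rewrite !mem_iota /= !add0n => i4 j4 ij;
       case: (ltngtP i j) => // lt; have := turn_inj r lt; rewrite ij eqxx; lia.
  rewrite -[4%N](size_map (turn r) (iota 0 4)) -(card_uniqP u); apply: subset_leq_card.
  by apply/subsetP => x /mapP[k]; rewrite mem_iota => /andP[_ k4] ->; apply: bT.
move=> m; pose D : {set line (loop n)} := [set turn m 1; turn m 2; turn m 3].
have neq i j : (i < j < i + n)%N -> (turn m i == turn m j) = false.
  by move=> /andP[ij ji]; apply/negbTE/turn_inj.
exists D, (turn m 2).
have DP p : reflect (exists2 k, (0 < k < 4)%N & p = turn m k) (p \in D).
  apply: (iffP idP) => [|[k k4 ->]].
    by rewrite !inE => /orP[/orP[]|]/eqP ->; [exists 1%N|exists 2|exists 3].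
  by case: k k4 => [|[|[|[|]]]] // _; rewrite !inE eqxx ?orbT.
split.
- apply/subsetP => p /DP[k k4 ->]; rewrite !inE eq_sym.
  by rewrite -[m in m == _]/(turn m 0) neq //; lia.
- have /subset_leq_card/leq_trans -> // :
      bordered D \subset [set x | x \in [seq turn m k | k <- iota 1 4]].
    apply/subsetP => b; rewrite inE => /exists_inP[e /DP[k k4 ->]] eb; rewrite inE.
    apply/mapP; case/orP: eb => /eqP ->; first by exists k; rewrite // mem_iota; lia.
    by exists k.+1; rewrite // mem_iota; lia.
  by rewrite cardsE; apply: leq_trans (card_size _) _; rewrite size_map size_iota.
- split; first by apply/DP; exists 2.
  apply/setP => b; rewrite in_set0; apply/negP => /claimedP[].
  case/orP => /eqP -> H.
    have /eqP : (turn m 1 : line (loop n)) = turn m 2.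
      by apply: H; [apply/DP; exists 1%N|rewrite /= eqxx orbT].
    by rewrite neq //; lia.
  have /eqP : (turn m 3 : line (loop n)) = turn m 2.
    by apply: H; [apply/DP; exists 3|rewrite /= eqxx].
  by rewrite eq_sym neq //; lia.
- move=> a; rewrite in_setD1 => /andP[a2 /DP[k k4 ak]]; subst a; apply/set0Pn.
  have [k1|k3] : k = 1%N \/ k = 3.
    by case: k k4 a2 => [|[|[|[|]]]] //; rewrite ?eqxx //; [left|right].
  + subst k; exists (turn m 1); apply/claimedP; split=> [|e]; first by rewrite /= eqxx.
    rewrite in_setD1 => /andP[e2 /DP[j j4 ej]]; subst e.
    move: j4 e2; case: j => [|[|[|[|]]]] //; first by rewrite eqxx.
    move=> _ _ /(@loop_borders_turn m 0)[]/eqP; rewrite eq_sym neq //; lia.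
  subst k; exists (turn m 3); apply/claimedP; split=> [|e]; first by rewrite /= eqxx.
  rewrite in_setD1 => /andP[e2 /DP[j j4 ej]]; subst e.
  move: j4 e2; case: j => [|[|[|[|]]]] //; last by rewrite eqxx.
  move=> _ _ /(@loop_borders_turn m 2)[]/eqP; rewrite neq //; lia.
move=> T DT TD mT; have [p pT pD] : exists2 p, p \in T & p \notin D.
  by apply/subsetPn; apply: contra TD => TD; rewrite eqEsubset TD DT.
have [k kn pk] := turn_surj m p.
have k4 : (4 <= k)%N.
  rewrite leqNgt; apply/negP => k4; case: (posnP k) => k0.
    by move: mT; rewrite -[m]/(turn m 0) -k0 -pk pT.
  by move/DP: pD => []; exists k; rewrite ?k0.
(* The drawn line [m] is read as [turn m n], so the search for a capture runs forward from [p] over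
   indices at least 4 and never meets [D]. *)
have : (turn m k \in T) != (turn m n \in T) by rewrite turnn -pk pT (negbTE mT).
case/(loop_capture (ltnW kn)) => j /andP[kj jn] [jT cj]; exists (turn m j) => //.
rewrite in_setD jT andbT; apply/DP => -[i i4 /eqP].
by rewrite eq_sym neq //; lia.
Qed.

End Loop.

(** * Isomorphisms that reorder components *)

Lemma is_iso_id (G : board) : @is_iso G G id id.
Proof. by split=> //; exists id. Qed.

Lemma is_iso_comp (G H K : board) f g f' g' :
  @is_iso G H f g -> @is_iso H K f' g' -> @is_iso G K (f' \o f) (g' \o g).
Proof.
move=> [bf bg fg] [bf' bg' fg']; split; [exact: bij_comp|exact: bij_comp|].
by move=> e b; rewrite /= fg' fg.
Qed.

Definition sum_map (A B C : Type) (f : B -> C) (x : A + B) : A + C :=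
  match x with inl a => inl a | inr b => inr (f b) end.

Definition sum_swap (A B C : Type) (x : A + (B + C)) : B + (A + C) :=
  match x with inl a => inr (inl a) | inr (inl b) => inl b | inr (inr c) => inr (inr c) end.

Lemma sum_map_bij (A B C : Type) (f : B -> C) :
  bijective f -> bijective (@sum_map A B C f).
Proof.
by move=> [g fK gK]; exists (sum_map g) => -[a|b] //=; rewrite (fK, gK).
Qed.

Lemma sum_swap_bij (A B C : Type) : bijective (@sum_swap A B C).
Proof. by exists (@sum_swap B A C) => -[a|[b|c]]. Qed.

Lemma is_iso_union (A G H : board) f g : @is_iso G H f g ->
  @is_iso (disjoint_union A G) (disjoint_union A H) (sum_map f) (sum_map g).
Proof.
move=> [bf bg fg]; split; [exact: sum_map_bij|exact: sum_map_bij|].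
by move=> [a|b] [c|d] //=.
Qed.

Lemma is_iso_swap (A B C : board) :
  @is_iso (disjoint_union A (disjoint_union B C))
          (disjoint_union B (disjoint_union A C)) (@sum_swap _ _ _) (@sum_swap _ _ _).
Proof.
split; [exact: sum_swap_bij|exact: sum_swap_bij|].
by move=> [a|[b|c]] [a'|[b'|c']].
Qed.

Lemma value_board_iso (G H : board) : board_iso G H -> value G = value H.
Proof.
move=> [f [g fg]]; have [_ [g' gK g'K] _] := fg.
rewrite /value -(value_iso _ fg); congr value_at; apply/setP => x.
by rewrite inE -[x]g'K imset_f ?inE.
Qed.

(* [(true, n)] codes the n-loop and [(false, n)] the n-chain. *)
Definition component_board (x : bool * nat) : board :=
  if x.1 then loop x.2 else chain x.2.

Definition components_board (s : seq (bool * nat)) : board :=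
  foldr disjoint_union empty_board (map component_board s).

Definition control_cost (x : bool * nat) : nat := if x.1 then 4 else 2.

Definition loony_length (x : bool * nat) : bool :=
  if x.1 then (4 <= x.2)%N else (3 <= x.2)%N.

Lemma component_loony x : loony_length x ->
  loony_component (component_board x) (control_cost x).
Proof. by case: x => -[] n; [apply: loop_loony|apply: chain_loony]. Qed.

Lemma card_component x : #|box (component_board x)| = x.2.
Proof. by case: x => -[] n; rewrite card_ord. Qed.

Lemma components_quiet s : all loony_length s -> quiet_board (components_board s).
Proof.
elim: s => [_ []|x s IH /= /andP[xl /IH sl]] //.
by apply: quiet_disjoint_union => //; apply: loony_quiet (component_loony xl).
Qed.

Lemma components_front s1 x s2 :
  board_iso (components_board (s1 ++ x :: s2)) (components_board (x :: s1 ++ s2)).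
Proof.
suff [f [g fg]] : exists f g, @is_iso (components_board (s1 ++ x :: s2))
    (components_board (x :: s1 ++ s2)) f g by exists f, g.
elim: s1 => [|y s1 [f [g fg]]]; first by exists id, id; apply: is_iso_id.
exists (@sum_swap _ _ _ \o sum_map f), (@sum_swap _ _ _ \o sum_map g).
exact: is_iso_comp (is_iso_union _ fg) (is_iso_swap _ _ _).
Qed.

Lemma board_iso_cons x s t :
  board_iso (components_board s) (components_board t) ->
  board_iso (components_board (x :: s)) (components_board (x :: t)).
Proof. by move=> [f [g fg]]; exists (sum_map f), (sum_map g); apply: is_iso_union. Qed.

Lemma board_iso_perm s t : perm_eq t s ->
  board_iso (components_board s) (components_board t).
Proof.
elim: t s => [|x t IH] s.
  by rewrite perm_sym => /perm_nilP ->; exists id, id; apply: is_iso_id.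
move=> st; have xs : x \in s by rewrite -(perm_mem st) mem_head.
case/splitPr: xs st => s1 s2; rewrite perm_sym -cat1s perm_catCA perm_cons perm_sym.
move=> /IH /(board_iso_cons x) [f' [g' fg']].
have [f [g fg]] := components_front s1 x s2.
by exists (f' \o f), (g' \o g); apply: is_iso_comp fg fg'.
Qed.

Lemma value_components_perm s t : perm_eq s t ->
  value (components_board s) = value (components_board t).
Proof. by rewrite perm_sym => /board_iso_perm/value_board_iso. Qed.

(** This lets the first move of the whole position be treated as a move in the head component, where
    [opening_value] applies. *)
Lemma components_line s (m : line (components_board s)) :
  exists x t (f : _ -> _) g (m' : line (component_board x)),
    [/\ perm_eq s (x :: t),
        @is_iso (components_board s) (components_board (x :: t)) f g & g m = inl m'].
Proof.
elim: s m => [[]|y s IH [m|m]].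
  by exists y, s, id, id, m; split=> //; apply: is_iso_id.
have [x [t [f [g [m' [st fg gm]]]]]] := IH m.
exists x, (y :: t), (@sum_swap _ _ _ \o sum_map f), (@sum_swap _ _ _ \o sum_map g), m'; split.
- apply: perm_trans (_ : perm_eq (y :: x :: t) _); first by rewrite perm_cons.
  by rewrite (perm_catCA [:: y] [:: x]).
- exact: is_iso_comp (is_iso_union _ fg) (is_iso_swap _ _ _).
by rewrite /= gm.
Qed.

(** * The recursion for the value of a union of components *)

Definition opening_cost (x : bool * nat) (v : int) : int :=
  x.2%:Z - (control_cost x)%:Z + `|v - (control_cost x)%:Z|.

(** The score is independent of [m] because control is available against every line of the
    component. A chain opened in the middle thus scores like one opened at an end. *)
Lemma value_after_opening x s m : all loony_length (x :: s) ->
  - value_at ([set: line (components_board (x :: s))] :\ inl m)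
    = opening_cost x (value (components_board s)).
Proof.
move=> /= /andP[xl sl]; rewrite /opening_cost -(card_component x) /value.
rewrite -(opening_value (component_loony xl) m (components_quiet sl)).
by congr (- value_at _); apply/setP => -[e|e]; rewrite !inE ?andbT.
Qed.

Lemma value_opening x s : all loony_length (x :: s) ->
  value (components_board (x :: s)) <= opening_cost x (value (components_board s)).
Proof.
move=> xs; have /andP[xl sl] := xs.
have [m _] := set0Pn _ (loony_line (component_loony xl)).
rewrite -(value_after_opening m) //; apply: value_quiet; first by rewrite inE.
exact: components_quiet.
Qed.

Lemma value_components_optimal s : all loony_length s -> s != [::] ->
  exists x t, perm_eq s (x :: t) /\
    value (components_board s) = opening_cost x (value (components_board t)).
Proof.
move=> sl s0; have qs := components_quiet sl.
have [m0 _] : exists m : line (components_board s), true.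
  case: s sl s0 {qs} => // x s /= /andP[xl _] _.
  by have [m _] := set0Pn _ (loony_line (component_loony xl)); exists (inl m).
have : [set: line (components_board s)] != set0 by apply/set0Pn; exists m0; rewrite inE.
case/value_optimal => m _; rewrite qs eqxx.
have [x [t [f [g [m' [st fg gm]]]]]] := components_line m.
rewrite -(value_iso (_ :\ m) fg); have [_ [g' gK g'K] _] := fg.
rewrite imsetD1_inj ?gm; last exact: can_inj gK.
have -> : g @: setT = setT.
  by apply/setP => y; rewrite inE -[y]g'K imset_f ?inE.
rewrite value_after_opening -?(perm_all _ st) // => vE.
by exists x, t.
Qed.

(** * The recursion on the lists of chain and loop lengths *)

Definition endgame_value (cs ls : seq nat) : int := value (endgame_board cs ls).

Definition components (cs ls : seq nat) : seq (bool * nat) :=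
  map (pair false) cs ++ map (pair true) ls.

Lemma endgame_valueE cs ls :
  endgame_value cs ls = value (components_board (components cs ls)).
Proof.
rewrite /endgame_value /endgame_board /components_board /components map_cat.
by rewrite -!map_comp.
Qed.

Lemma components_loony cs ls :
  all loony_length (components cs ls) = all (leq 3) cs && all (leq 4) ls.
Proof. by rewrite all_cat !all_map. Qed.

Lemma endgame_value_perm cs cs' ls ls' : perm_eq cs cs' -> perm_eq ls ls' ->
  endgame_value cs ls = endgame_value cs' ls'.
Proof.
move=> pc pl; rewrite !endgame_valueE; apply: value_components_perm.
by rewrite perm_cat ?perm_map.
Qed.

Lemma endgame_value_chain c cs ls : all (leq 3) (c :: cs) -> all (leq 4) ls ->
  endgame_value (c :: cs) ls <= c%:Z - 2 + `|endgame_value cs ls - 2|.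
Proof.
move=> c3 l4; rewrite !endgame_valueE.
have := @value_opening (false, c) (components cs ls).
by rewrite -[_ :: _]/(components (c :: cs) ls) components_loony c3; apply.
Qed.

Lemma endgame_value_loop l cs ls : all (leq 3) cs -> all (leq 4) (l :: ls) ->
  endgame_value cs (l :: ls) <= l%:Z - 4 + `|endgame_value cs ls - 4|.
Proof.
move=> c3 l4; rewrite !endgame_valueE.
have pl : perm_eq (components cs (l :: ls)) ((true, l) :: components cs ls).
  by rewrite /components /= -cat1s perm_catCA.
rewrite (value_components_perm pl); apply: (@value_opening (true, l)).
by rewrite -(perm_all _ pl) components_loony c3.
Qed.

Lemma endgame_value_nil : endgame_value [::] [::] = 0.
Proof.
rewrite /endgame_value /value (_ : [set: _] = set0) ?value_at0 //.
by apply/setP => -[].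
Qed.

Lemma endgame_value_optimal cs ls : all (leq 3) cs -> all (leq 4) ls ->
    ~~ (nilp cs && nilp ls) ->
  (exists c cs', perm_eq cs (c :: cs') /\
     endgame_value cs ls = c%:Z - 2 + `|endgame_value cs' ls - 2|) \/
  (exists l ls', perm_eq ls (l :: ls') /\
     endgame_value cs ls = l%:Z - 4 + `|endgame_value cs ls' - 4|).
Proof.
move=> c3 l4 s0.
have [] := @value_components_optimal (components cs ls).
- by rewrite components_loony c3.
- by move: s0; case: (cs) (ls) => [|? ?] [].
move=> [[] n] [t [st vE]].
  have nls : n \in ls.
    have : (true, n) \in components cs ls by rewrite (perm_mem st) mem_head.
    by rewrite mem_cat => /orP[]/mapP[y yl] // [->].
  right; exists n, (rem n ls); split; first exact: perm_to_rem.
  rewrite !endgame_valueE vE /opening_cost /=; congr (_ + `|_ - _|).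
  apply: value_components_perm; rewrite -(perm_cons (true, n)) -(permPl st).
  apply: perm_trans (_ : perm_eq (components cs (n :: rem n ls)) _).
    by rewrite perm_cat2l; apply/perm_map/perm_to_rem.
  by rewrite (perm_catCA _ [:: (true, n)]).
have ncs : n \in cs.
  have : (false, n) \in components cs ls by rewrite (perm_mem st) mem_head.
  by rewrite mem_cat => /orP[]/mapP[y yl] // [->].
left; exists n, (rem n cs); split; first exact: perm_to_rem.
rewrite !endgame_valueE vE /opening_cost /=; congr (_ + `|_ - _|).
apply: value_components_perm; rewrite -(perm_cons (false, n)) -(permPl st).
rewrite -cat_cons -map_cons perm_cat2r.
by apply/perm_map/perm_to_rem.
Qed.

(** * Arithmetic of the controlled value *)

Lemma fcv_chain c cs ls : fcv (c :: cs) ls = c%:Z - 4 + fcv cs ls.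
Proof. by rewrite /fcv big_cons addrA. Qed.

Lemma fcv_loop l cs ls : fcv cs (l :: ls) = l%:Z - 8 + fcv cs ls.
Proof. by rewrite /fcv big_cons addrCA. Qed.

Lemma fcv_split cs ls : fcv cs ls = fcv cs [::] + fcv [::] ls.
Proof. by rewrite /fcv !big_nil addr0 add0r. Qed.

Lemma fcv_nil : fcv [::] [::] = 0.
Proof. by rewrite /fcv !big_nil. Qed.

Lemma cv_perm cs cs' ls ls' : perm_eq cs cs' -> perm_eq ls ls' -> cv cs ls = cv cs' ls'.
Proof.
move=> pc pl; rewrite /cv /fcv /tb (perm_big _ pc) (perm_big _ pl) (perm_has _ pc).
by rewrite /nilp (perm_size pc) (perm_size pl).
Qed.

Lemma cv_chain c cs ls :
  cv (c :: cs) ls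
    = c%:Z - 4 + fcv cs ls
      + (if [|| (4 <= c)%N, has (leq 4) cs | nilp ls] then 4 else 6).
Proof. by rewrite /cv fcv_chain /tb /= -orbA. Qed.

Lemma cv_loop l cs ls :
  cv cs (l :: ls)
    = l%:Z - 8 + fcv cs ls
      + (if has (leq 4) cs then 4 else if nilp cs then 8 else 6).
Proof. by rewrite /cv fcv_loop /tb /= andbF orbF. Qed.

Definition loony_lengths (cs ls : seq nat) : bool :=
  all (leq 3) cs && all (fun l => (4 <= l)%N && ~~ odd l) ls.

Lemma loony_lengths_perm cs cs' ls ls' : perm_eq cs cs' -> perm_eq ls ls' ->
  loony_lengths cs ls = loony_lengths cs' ls'.
Proof. by move=> pc pl; rewrite /loony_lengths (perm_all _ pc) (perm_all _ pl). Qed.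

Lemma loony_loops cs ls : loony_lengths cs ls -> all (leq 4) ls.
Proof. by move=> /andP[_]; apply: sub_all => l /andP[]. Qed.

Lemma loony_chain c cs ls :
  loony_lengths (c :: cs) ls = (3 <= c)%N && loony_lengths cs ls.
Proof. by rewrite /loony_lengths /= andbA. Qed.

Lemma loony_loop l cs ls :
  loony_lengths cs (l :: ls) = [&& (4 <= l)%N, ~~ odd l & loony_lengths cs ls].
Proof. by rewrite /loony_lengths /= andbCA -andbA. Qed.

Lemma value_chain_le c cs ls : loony_lengths (c :: cs) ls ->
  endgame_value (c :: cs) ls <= c%:Z - 2 + `|endgame_value cs ls - 2|.
Proof. by move=> L; apply: endgame_value_chain (loony_loops L); case/andP: L. Qed.

Lemma value_loop_le l cs ls : loony_lengths cs (l :: ls) ->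
  endgame_value cs (l :: ls) <= l%:Z - 4 + `|endgame_value cs ls - 4|.
Proof. by move=> L; apply: endgame_value_loop (loony_loops L); case/andP: L. Qed.

Lemma mem_perm_cons (x : nat) (s : seq nat) :
  x \in s -> exists s' : seq nat, perm_eq s (x :: s').
Proof. by move=> /perm_to_rem; exists (rem x s). Qed.

Lemma perm_chain (c : nat) (cs cs' ls : seq nat) : perm_eq cs (c :: cs') ->
  [/\ cv cs ls = cv (c :: cs') ls, endgame_value cs ls = endgame_value (c :: cs') ls
    & loony_lengths cs ls = loony_lengths (c :: cs') ls].
Proof.
move=> pc; have pl := perm_refl ls.
by rewrite (cv_perm pc pl) (endgame_value_perm pc pl) (loony_lengths_perm pc pl).
Qed.

Lemma perm_loop (l : nat) (cs ls ls' : seq nat) : perm_eq ls (l :: ls') ->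
  [/\ cv cs ls = cv cs (l :: ls'), endgame_value cs ls = endgame_value cs (l :: ls')
    & loony_lengths cs ls = loony_lengths cs (l :: ls')].
Proof.
move=> pl; have pc := perm_refl cs.
by rewrite (cv_perm pc pl) (endgame_value_perm pc pl) (loony_lengths_perm pc pl).
Qed.

(* Induction along the removal of the component that is opened first in optimal play. *)
Lemma endgame_value_ind (P : seq nat -> seq nat -> int -> Prop) :
    (forall cs cs' ls ls' v, perm_eq cs cs' -> perm_eq ls ls' -> P cs ls v -> P cs' ls' v) ->
    P [::] [::] 0 ->
    (forall c cs ls, loony_lengths (c :: cs) ls -> P cs ls (endgame_value cs ls) ->
       P (c :: cs) ls (c%:Z - 2 + `|endgame_value cs ls - 2|)) ->
    (forall l cs ls, loony_lengths cs (l :: ls) -> P cs ls (endgame_value cs ls) ->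
       P cs (l :: ls) (l%:Z - 4 + `|endgame_value cs ls - 4|)) ->
  forall cs ls, loony_lengths cs ls -> P cs ls (endgame_value cs ls).
Proof.
move=> Pperm P0 Pc Pl cs ls.
have [n] := ubnP (size cs + size ls)%N; elim: n cs ls => // n IH cs ls; rewrite ltnS => sn L.
case: (boolP (nilp cs && nilp ls)) => [/andP[/nilP -> /nilP ->]|ne].
  by rewrite endgame_value_nil.
case: (endgame_value_optimal _ (loony_loops L) ne) => [|[c [cs' [pc ->]]]|[l [ls' [pl ->]]]].
- by case/andP: L.
- rewrite (loony_lengths_perm pc (perm_refl ls)) in L.
  apply: (Pperm (c :: cs') _ ls); rewrite 1?perm_sym //; apply: Pc => //.
  apply: IH; last by move: L; rewrite loony_chain => /andP[].
  by move: sn; rewrite (perm_size pc).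
rewrite (loony_lengths_perm (perm_refl cs) pl) in L.
apply: (Pperm cs _ (l :: ls')); rewrite 1?perm_sym //; apply: Pl => //.
apply: IH; last by move: L; rewrite loony_loop => /and3P[].
by move: sn; rewrite (perm_size pl) /= addnS.
Qed.

(** * Parity, the lower bound, and controlled value at least 2 *)

Lemma endgame_value_ge0 cs ls : loony_lengths cs ls -> 0 <= endgame_value cs ls.
Proof.
move: cs ls; apply: (endgame_value_ind (P := fun _ _ v => 0 <= v)) => // [c cs ls|l cs ls].
  by rewrite loony_chain => /andP[c3 _]; lia.
by rewrite loony_loop => /and3P[l4 _ _]; lia.
Qed.

(** The control costs c are even, so n - c + |v - c| has the parity of n + v, and [fcv] changes by n
    modulo 2 as well. The terminal bonus is always even. *)
Lemma endgame_value_parity cs ls : loony_lengths cs ls ->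
  exists k : int, endgame_value cs ls = cv cs ls + k * 2.
Proof.
move=> L; suff [k ->] : exists k : int, endgame_value cs ls = fcv cs ls + k * 2.
  rewrite /cv /tb; case: ifP => _; first by exists k; lia.
  case: ifP => _; first by exists (k - 2); lia.
  by case: ifP => _; [exists (k - 4) | exists (k - 3)]; lia.
move: cs ls L; apply: (endgame_value_ind (P := fun cs ls v => exists k, v = fcv cs ls + k * 2)).
- move=> cs cs' ls ls' v pc pl [k ->]; exists k.
  by rewrite /fcv (perm_big _ pc) (perm_big _ pl).
- by exists 0; rewrite fcv_nil.
- move=> c cs ls _ [k kE]; rewrite fcv_chain.
  case: (lerP 2 (endgame_value cs ls)) => v2; first by exists k; lia.
  by exists (2 - fcv cs ls - k); lia.
move=> l cs ls _ [k kE]; rewrite fcv_loop.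
case: (lerP 4 (endgame_value cs ls)) => v4; first by exists k; lia.
by exists (4 - fcv cs ls - k); lia.
Qed.

(** This serves the one case where a loop joining a non-empty remainder raises the terminal bonus; a
    lower bound on the value of the remainder is not enough there. *)
Lemma endgame_value_threes cs : all (leq 3) cs -> ~~ has (leq 4) cs ->
  fcv cs [::] = - (size cs)%:Z /\ endgame_value cs [::] <= (size cs)%:Z + 2.
Proof.
elim: cs => [|c cs IH] /=; first by rewrite fcv_nil endgame_value_nil.
move=> /andP[c3 cs3]; rewrite negb_or -ltnNge ltnS => /andP[c3' cs4].
have [fE vE] := IH cs3 cs4; rewrite fcv_chain fE.
have L : loony_lengths (c :: cs) [::] by rewrite /loony_lengths /= c3 cs3.
have L' : loony_lengths cs [::] by move: L; rewrite loony_chain => /andP[].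
by have := value_chain_le L; have := endgame_value_ge0 L'; lia.
Qed.

(** By |v - c| >= v - c the bound passes from the remainder to the whole unless adding the component
    raises the terminal bonus. That happens only over an empty remainder, or when a loop joins
    3-chains alone. *)
Lemma cv_le_endgame_value cs ls : loony_lengths cs ls -> cv cs ls <= endgame_value cs ls.
Proof.
move: cs ls; apply: (endgame_value_ind (P := fun cs ls v => cv cs ls <= v)).
- by move=> cs cs' ls ls' v pc pl; rewrite (cv_perm pc pl).
- by rewrite /cv fcv_nil.
- move=> c cs ls L; rewrite cv_chain /cv /tb.
  case: (boolP (nilp cs && nilp ls)) => [/andP[/nilP -> /nilP ->]|].
    by rewrite fcv_nil endgame_value_nil orbT; lia.
  by case: (nilp cs); case: (nilp ls); case: (has _ cs); case: (4 <= c)%N;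
    rewrite //= ?orbT; lia.
move=> l cs ls L; rewrite cv_loop /cv /tb.
case: (boolP (nilp cs && nilp ls)) => [/andP[/nilP -> /nilP ->]|].
  by rewrite fcv_nil endgame_value_nil /=; lia.
move: L; rewrite loony_loop => /and3P[l4 _ L].
case: (boolP (has _ cs)) => h /=; first by lia.
case: (boolP (nilp ls)) => [/nilP ->|_]; last by case: (nilp cs); lia.
(* Here the bonus rises from 4 to 6. With k 3-chains the remainder has value at most k + 2, so |v -
   4| is at least 2 - k, which is what is needed. *)
have [|fE vE] := endgame_value_threes _ h; first by case/andP: L.
by rewrite andbT => /negbTE ->; rewrite fE; lia.
Qed.

(** Opening a loop reproduces the controlled value if the bonus is unchanged and the remainder has
    controlled value at least 4. Starting from at least 2, a loop of length at most 6 achieves this;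
    if there is none, the remaining loops contribute nonnegatively. *)
Lemma loop_to_open cs ls : loony_lengths cs ls -> ~~ nilp ls ->
  exists (l : nat) (ls' : seq nat), [/\ perm_eq ls (l :: ls'), loony_lengths cs (l :: ls') &
    (l <= 6)%N \/ (8 <= l)%N /\ 0 <= fcv [::] ls'].
Proof.
move=> L ls0; case: (boolP (has (fun l => l <= 6)%N ls)) => [/hasP[l lls l6]|].
  exists l, (rem l ls); split; [exact: perm_to_rem| |by left].
  by rewrite -(loony_lengths_perm (perm_refl cs) (perm_to_rem lls)).
rewrite -all_predC => long.
have {long} long : all (leq 8) ls.
  case/andP: L => _; elim: (ls) long => //= l s IH /andP[l6 /IH long] /andP[/andP[_ odl] /long ->].
  by rewrite andbT; lia.
case: ls ls0 L long => // l ls _ L /= /andP[l8 long]; exists l, ls; split=> //; right.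
split=> //; elim: ls long {L} => [_|l' s IH /= /andP[l8' /IH]]; first by rewrite fcv_nil.
by rewrite fcv_loop; lia.
Qed.

Lemma fcv_ge0 cs : all (leq 4) cs -> 0 <= fcv cs [::].
Proof. by elim: cs => [_|c cs IH /= /andP[c4 /IH]]; rewrite ?fcv_nil // fcv_chain; lia. Qed.

Lemma three_mem cs : all (leq 3) cs -> 3%N \in cs \/ all (leq 4) cs.
Proof.
move=> c3; case: (boolP (3%N \in cs)) => [|n3]; [by left|right].
apply/allP => c cc; have := allP c3 c cc; rewrite leq_eqVlt => /orP[/eqP cE|//].
by rewrite cE cc in n3.
Qed.

(** A component is opened whose remainder has controlled value at least the control cost, so that
    the absolute value opens with a plus sign and the recursion returns [cv]. Small remainders are
    computed directly. *)
Lemma endgame_value_le_cv cs ls : loony_lengths cs ls -> 2 <= cv cs ls ->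
  endgame_value cs ls <= cv cs ls.
Proof.
have [n] := ubnP (size cs + size ls)%N; elim: n cs ls => // n IH cs ls; rewrite ltnS => sn L.
have {}IH cs' ls' : (size cs' + size ls' < size cs + size ls)%N -> loony_lengths cs' ls' ->
    2 <= cv cs' ls' -> endgame_value cs' ls' = cv cs' ls'.
  move=> s' L' cv2; apply/eqP; rewrite eq_le cv_le_endgame_value // IH //.
  exact: leq_trans s' sn.
have [c3|c4] : 3%N \in cs \/ all (leq 4) cs by apply: three_mem; case/andP: L.
  have [cs' pc] := mem_perm_cons c3.
  have [-> -> LE] := perm_chain ls pc; rewrite LE in L.
  have L' : loony_lengths cs' ls by move: L; rewrite loony_chain => /andP[].
  have v_le := value_chain_le L; move: sn IH; rewrite (perm_size pc) => sn IH.
  (* If another chain remains, the bonus is unchanged and opening the 3-chain raises [cv] by 1. *)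
  have [/nilP cs0|cs0] := boolP (nilp cs'); last first.
    have : cv cs' ls = cv (3%N :: cs') ls + 1.
      rewrite cv_chain /cv /tb (negbTE cs0) /=.
      by case: (has _ _ || _); lia.
    move=> cvE cv2; suff : endgame_value cs' ls = cv cs' ls by lia.
    by apply: IH; rewrite ?cvE //=; lia.
  subst cs'; have v3 : endgame_value [:: 3%N] [::] = 3.
    have L3 : loony_lengths [:: 3%N] [::] by [].
    have := cv_le_endgame_value L3; have := value_chain_le L3.
    by rewrite cv_chain endgame_value_nil fcv_nil /=; lia.
  have [/nilP ls0|ls0] := boolP (nilp ls).
    by subst ls; rewrite v3 cv_chain fcv_nil.
  (* The 3-chain is the only chain; removing it would change the bonus, so a loop is opened
     instead. *)
  have [l [ls' [pl Ll lE]]] := loop_to_open L ls0.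
  have [l4 odl Ll'] := and3P (etrans (esym (loony_loop l [:: 3%N] ls')) Ll).
  have [-> -> _] := perm_loop [:: 3%N] pl.
  have := value_loop_le Ll; rewrite cv_loop /= fcv_chain.
  have [/nilP ls'0|ls'0] := boolP (nilp ls').
    by subst ls'; rewrite v3 fcv_nil; lia.
  have := IH [:: 3%N] ls'; rewrite (perm_size pl) /= => /(_ _ Ll').
  by rewrite cv_chain (negbTE ls'0) /=; lia.
have [/nilP ls0|ls0] := boolP (nilp ls).
  subst ls; case: cs c4 L sn IH => [|c cs] /=; first by rewrite /cv fcv_nil.
  move=> /andP[c4 cs4] L sn IH; have L' : loony_lengths cs [::].
    by move: L; rewrite loony_chain => /andP[].
  have := value_chain_le L; rewrite cv_chain c4 /=.
  have [/nilP cs0|cs0] := boolP (nilp cs).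
    by subst cs; rewrite fcv_nil endgame_value_nil; lia.
  have := IH cs [::]; rewrite /= => /(_ _ L'); rewrite /cv /tb (negbTE cs0) orbT /=.
  by have := fcv_ge0 cs4; lia.
have [l [ls' [pl Ll lE]]] := loop_to_open L ls0.
have [l4 odl Ll'] := and3P (etrans (esym (loony_loop l cs ls')) Ll).
have [-> -> _] := perm_loop cs pl.
have := value_loop_le Ll; rewrite cv_loop.
have := IH cs ls'; rewrite (perm_size pl) /= => /(_ _ Ll').
have hE : has (leq 4) cs = ~~ nilp cs.
  by case: cs c4 {L sn IH Ll Ll'} => //= c cs /andP[->].
rewrite /cv /tb hE; have := fcv_ge0 c4; rewrite [fcv cs ls']fcv_split.
have [/nilP ->|cs0] := boolP (nilp cs) => /=; last by lia.
have [/nilP ->|ls'0] /= := boolP (nilp ls'); last by rewrite fcv_nil; lia.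
by rewrite endgame_value_nil fcv_nil; lia.
Qed.

Lemma endgame_value_eq_cv cs ls : loony_lengths cs ls -> 2 <= cv cs ls ->
  endgame_value cs ls = cv cs ls.
Proof.
by move=> L cv2; apply/eqP; rewrite eq_le cv_le_endgame_value // endgame_value_le_cv.
Qed.

(** * Controlled value below 2 *)

Lemma cv_open_three (cs ls : seq nat) :
  cv cs ls = cv (3%N :: cs) ls + 1 \/
  cs = [::] /\ cv cs ls <= cv (3%N :: cs) ls + 3.
Proof.
rewrite cv_chain /cv /tb; case: cs => [|c cs] /=.
  (* When only loops remain the bonus goes from 6 to 8, which makes the increase 3. *)
  by right; split=> //; case: (nilp ls); lia.
by left; case: ifP; lia.
Qed.

Lemma cv_open_loop_le (l : nat) (cs ls : seq nat) :
  cv cs ls <= cv cs (l :: ls) + 8 - l%:Z.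
Proof.
rewrite cv_loop /cv /tb.
by case: (has _ _); case: (nilp cs); case: (nilp ls) => /=; lia.
Qed.

(** A remainder has value at most 4 by induction, or value equal to its [cv], which exceeds the
    original [cv] by a bounded amount. Opening a 3-chain, else a 4-loop, else a 6-loop then gives
    the bound. With none of these [fcv] is nonnegative, and [cv] below 2 forces the empty game. *)
Lemma endgame_value_le4 cs ls : loony_lengths cs ls -> cv cs ls < 2 ->
  endgame_value cs ls <= 4 /\ (3%N \in cs -> endgame_value cs ls <= 3).
Proof.
have [n] := ubnP (size cs + size ls)%N; elim: n cs ls => // n IH cs ls; rewrite ltnS => sn L cv2.
have {}IH cs' ls' : (size cs' + size ls' < size cs + size ls)%N -> loony_lengths cs' ls' ->
    0 <= endgame_value cs' ls' /\
    (endgame_value cs' ls' <= 4 \/ endgame_value cs' ls' = cv cs' ls').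
  move=> s' L'; split; first exact: endgame_value_ge0.
  case: (ltrP (cv cs' ls') 2) => [lt2|]; last by right; apply: endgame_value_eq_cv.
  by left; case: (IH cs' ls' (leq_trans s' sn) L' lt2).
have [c3|c4] : 3%N \in cs \/ all (leq 4) cs by apply: three_mem; case/andP: L.
  suff : endgame_value cs ls <= 3 by lia.
  have [cs' pc] := mem_perm_cons c3.
  have [cvE -> LE] := perm_chain ls pc; rewrite LE in L; rewrite cvE in cv2.
  have L' : loony_lengths cs' ls by move: L; rewrite loony_chain => /andP[].
  have [|v0 vE] := IH cs' ls _ L'; first by rewrite (perm_size pc) /=; lia.
  by have := value_chain_le L; have := cv_open_three cs' ls; lia.
have n3 : 3%N \notin cs by apply/negP => /(allP c4).
suff : endgame_value cs ls <= 4 by rewrite (negbTE n3).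
case: (boolP (4%N \in ls)) => [/mem_perm_cons[ls' pl]|l4].
  have [cvE -> LE] := perm_loop cs pl; rewrite LE in L; rewrite cvE in cv2.
  have L' : loony_lengths cs ls' by move: L; rewrite loony_loop => /and3P[].
  have [|v0 vE] := IH cs ls' _ L'; first by rewrite (perm_size pl) /=; lia.
  by have := value_loop_le L; have := cv_open_loop_le 4 cs ls'; lia.
have {l4} l6 : all (leq 6) ls.
  apply/allP => l ll; case/andP: L => _ /allP/(_ l ll)/andP[l4' odl].
  have : l != 4%N by apply: contraNneq l4 => <-.
  by lia.
case: (boolP (6%N \in ls)) => [/mem_perm_cons[ls' pl]|l6'].
  have l6' : all (leq 6) ls' by move: l6; rewrite (perm_all _ pl).
  have [cvE -> LE] := perm_loop cs pl; rewrite LE in L; rewrite cvE in cv2.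
  have L' : loony_lengths cs ls' by move: L; rewrite loony_loop => /and3P[].
  have [|v0 vE] := IH cs ls' _ L'; first by rewrite (perm_size pl) /=; lia.
  (* The bound 2 + |v - 4| <= 4 requires v >= 2. Chains have length at least 4 and loops at least 6
     here, so any opening in the remainder contributes at least 2; an empty remainder would mean a
     single 6-loop, with [cv] equal to 6. *)
  suff : 2 <= endgame_value cs ls'.
    by have := value_loop_le L; have := cv_open_loop_le 6 cs ls'; lia.
  case: (boolP (nilp cs && nilp ls')) => [/andP[/nilP cs0 /nilP ls0]|ne].
    by move: cv2; rewrite cs0 ls0 cv_loop fcv_nil /=; lia.
  case: (endgame_value_optimal _ (loony_loops L') ne) => [|[c [cs' [pc ->]]]|[l [ls2 [pl' ->]]]].
  - by case/andP: L'.
  - have : (4 <= c)%N by apply: (allP c4); rewrite (perm_mem pc) mem_head.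
    by lia.
  have : (6 <= l)%N by apply: (allP l6'); rewrite (perm_mem pl') mem_head.
  by lia.
have fl : 0 <= fcv [::] ls.
  have : all (leq 8) ls.
    apply/allP => l ll; case/andP: L => _ /allP/(_ l ll)/andP[_ odl].
    have : l != 6%N by apply: contraNneq l6' => <-.
    by have := allP l6 l ll; lia.
  by elim: (ls) => [_|l s IHs /= /andP[l8 /IHs]]; rewrite ?fcv_nil // fcv_loop; lia.
move: cv2; rewrite /cv fcv_split /tb; have := fcv_ge0 c4.
case: (boolP (nilp cs && nilp ls)) => [/andP[/nilP -> /nilP ->]|_].
  by rewrite endgame_value_nil.
by case: (has _ _); case: (nilp cs); case: (nilp ls); rewrite /=; lia.
Qed.

Lemma fcv_loops_even ls : loony_lengths [::] ls ->
  exists k : int, fcv [::] ls = k * 2.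
Proof.
elim: ls => [_|l ls IH]; first by exists 0; rewrite fcv_nil.
rewrite loony_loop => /and3P[_ odl /IH[k kE]]; exists (k + (l./2)%:Z - 4).
by rewrite fcv_loop kE; lia.
Qed.

Definition exceptional (cs ls : seq nat) : bool :=
  (4%N \in ls) && (cv cs (rem 4%N ls) == 4).

(** It is immaterial which 4-loop is removed, as [cv] is invariant under reordering. *)
Lemma exceptionalP (cs ls : seq nat) :
  reflect (exists2 ls' : seq nat, perm_eq ls (4%N :: ls') & cv cs ls' = 4) (exceptional cs ls).
Proof.
apply: (iffP andP) => [[l4 /eqP cv4]|[ls' pl cv4]].
  by exists (rem 4%N ls); first exact: perm_to_rem.
have l4 : 4%N \in ls by rewrite (perm_mem pl) mem_head.
split=> //; rewrite -cv4; apply/eqP/cv_perm => //.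
by rewrite -(perm_cons 4%N) -(permPr pl) perm_sym perm_to_rem.
Qed.

(** Opening a 3-chain leaves an odd value at most 4, hence 1 or 3, which yields at most 2. Parity
    leaves 0 and 2, and 0 arises only by opening a 4-loop over a remainder of value 4. *)
Lemma endgame_value_even cs ls (k : int) : loony_lengths cs ls -> 3%N \in cs ->
    cv cs ls = k * 2 -> cv cs ls < 2 ->
  endgame_value cs ls = if exceptional cs ls then 0 else 2.
Proof.
move=> L c3 cvk cv2; have v0 := endgame_value_ge0 L.
have [j vj] := endgame_value_parity L.
have v2 : endgame_value cs ls <= 2.
  have [cs' pc] := mem_perm_cons c3.
  move: L cv2 cvk {v0 vj}; have [-> -> ->] := perm_chain ls pc => L cv2 cvk.
  have L' : loony_lengths cs' ls by move: L; rewrite loony_chain => /andP[].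
  have [i vi] := endgame_value_parity L'; have v0 := endgame_value_ge0 L'.
  have v_le := value_chain_le L.
  case: (cv_open_three cs' ls) => [cvE|[cs0 _]].
    have cv'2 : cv cs' ls < 2 by lia.
    by have [v4 _] := endgame_value_le4 L' cv'2; lia.
  (* With the 3-chain as only chain [cv] is odd, since the loops and the bonus contribute evenly;
     the case is void. *)
  subst cs'; have [h hE] := fcv_loops_even L'.
  by move: cvk; rewrite cv_chain hE; case: ifP; lia.
case: (boolP (exceptional cs ls)) => [/exceptionalP[ls' pl cv4]|nexc].
  move: L v0; have [_ -> ->] := perm_loop cs pl => L v0.
  have L' : loony_lengths cs ls' by move: L; rewrite loony_loop => /and3P[].
  by have := value_loop_le L; rewrite (endgame_value_eq_cv L') cv4; lia.
suff : endgame_value cs ls != 0 by lia.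
have ne : ~~ (nilp cs && nilp ls) by case: (cs) c3.
case: (endgame_value_optimal _ (loony_loops L) ne) => [|[c [cs' [pc ->]]]|[l [ls' [pl vE]]]].
- by case/andP: L.
- have : (3 <= c)%N by case/andP: L => /allP cs3 _; apply: cs3; rewrite (perm_mem pc) mem_head.
  by lia.
have [_ _ LE] := perm_loop cs pl.
have [l4 _ L'] : [/\ (4 <= l)%N, ~~ odd l & loony_lengths cs ls'].
  by apply/and3P; rewrite -loony_loop -LE.
rewrite vE; apply: contra nexc => /eqP lE; apply/exceptionalP; exists ls'.
  by rewrite (_ : 4%N = l) //; lia.
have v4 : endgame_value cs ls' = 4 by lia.
(* Because a 3-chain is present, [cv] below 2 would bound the value by 3. So [cv] is at least 2 and
   equals the value 4. *)
case: (ltrP (cv cs ls') 2) => [lt2|/(endgame_value_eq_cv L')]; last by rewrite v4.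
by have [_ /(_ c3)] := endgame_value_le4 L' lt2; rewrite v4.
Qed.

(** After one 3-chain is opened the other keeps the bonus fixed, so [cv] rises by exactly 1 and
    becomes even. The remainder then has value 2, except when it is exceptional. *)
Lemma endgame_value_odd cs ls (k : int) : loony_lengths cs ls -> (2 <= count_mem 3%N cs)%N ->
    cv cs ls = k * 2 + 1 -> cv cs ls < 2 ->
  endgame_value cs ls = 1.
Proof.
move=> L c33 cvk cv2; have v0 := endgame_value_ge0 L.
have [j vj] := endgame_value_parity L.
suff : endgame_value cs ls <= 1 by lia.
have c3 : 3%N \in cs by rewrite -has_pred1 has_count; apply: leq_trans c33.
have [cs' pc] := mem_perm_cons c3.
have c3' : 3%N \in cs'.
  by move: c33; rewrite (permP pc) /= -has_pred1 has_count.
have [cvE vE LE] := perm_chain ls pc; have L3 := L; rewrite LE in L3.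
have cs0 : cs' <> [::] by move=> cs0; rewrite cs0 in c3'.
have open_cv ls2 : cv cs' ls2 = cv (3%N :: cs') ls2 + 1.
  by case: (cv_open_three cs' ls2) => // -[].
have L' : loony_lengths cs' ls by move: L3; rewrite loony_chain => /andP[].
have v_le : endgame_value cs ls <= 1 + `|endgame_value cs' ls - 2|.
  by rewrite vE; have := value_chain_le L3; lia.
case: (ltrP (cv cs' ls) 2) => [lt2|ge2]; last first.
  by have := endgame_value_eq_cv L' ge2; have := open_cv ls; lia.
have v' := @endgame_value_even cs' ls (k + 1) L' c3' _ lt2.
have {}v' : endgame_value cs' ls = if exceptional cs' ls then 0 else 2.
  by apply: v'; rewrite open_cv -cvE cvk; lia.
case: (boolP (exceptional cs' ls)) v' => [/exceptionalP[ls' pl cv4] _|_]; last by lia.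
(* In the exceptional case the 3-chain would only give 3. Opening the 4-loop instead leaves both
   3-chains and controlled value 4 - 1 = 3, whence |3 - 4| = 1. *)
have cv3 : cv cs ls' = 3.
  by have [-> _ _] := perm_chain ls' pc; have := open_cv ls'; lia.
have [_ -> LE4] := perm_loop cs pl; rewrite LE4 in L.
have L4 : loony_lengths cs ls' by move: L; rewrite loony_loop => /and3P[].
by have := value_loop_le L; rewrite (endgame_value_eq_cv L4) cv3.
Qed.

Theorem corollary30 (G : position) (cs ls : seq nat)
    (hG : simple_loony_endgame G cs ls)
    (h3 : (2 <= count_mem 3 cs)%N) :
  [/\ 2 <= cv cs ls -> value G = cv cs ls,
      cv cs ls < 2 -> (2 %| cv cs ls)%Z ->
        value G = if (4%N \in ls) && (cv cs (rem 4%N ls) == 4) then 0 else 2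
    & cv cs ls < 2 -> ~~ (2 %| cv cs ls)%Z -> value G = 1].
Proof.
have [cs3 ls4 /value_board_iso ->] := hG.
have L : loony_lengths cs ls by rewrite /loony_lengths cs3.
have c3 : 3%N \in cs by rewrite -has_pred1 has_count; apply: leq_trans h3.
split=> [|cv2 /dvdzP[k cvk]|cv2 odd_cv].
- exact: endgame_value_eq_cv.
- exact: (endgame_value_even L c3 cvk).
apply: (@endgame_value_odd _ _ (cv cs ls %/ 2)%Z) => //.
by move: odd_cv; rewrite {2}(divz_eq (cv cs ls) 2); lia.
Qed.
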